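(* Let $\eta\in[0,2\pi)$ and let $G$ be a weakly connected mixed graph on $n$ vertices equipped with its $\eta$-function $\theta$. Assume that $G$ is $k$-regular (with $k\ge 1$) and periodic. Then: (i) $\frac{2n}{k}\in\mathbb{Z}$; and (ii) if $G$ is an undirected graph with $t$ triangles, then $\frac{16t}{k^3}\in\mathbb{Z}$.
   Context: A mixed graph $G=(V,\mathcal{A})$ consists of a finite vertex set $V$ and a subset $\mathcal{A} \subset V\times V \setminus \{(x,x) \mid x\in V\}$ of arcs. For an arc $a=(x,y)$, write $o(a)=x$, $t(a)=y$, $a^{-1}=(y,x)$. Let $\mathcal{A}^{-1}=\{a^{-1} \mid a\in\mathcal{A}\}$ and $\mathcal{A}^{\pm}=\mathcal{A}\cup\mathcal{A}^{-1}$. The underlying graph $G^{\pm}=(V,\mathcal{A}^{\pm})$ is regarded as an undirected simple graph; $G$ is weakly connected if $G^{\pm}$ is connected. Let $\deg_G x=\deg_{G^{\pm}}x$; $G$ is $k$-regular if $\deg_G x=k$ for all $x\in V$. An undirected graph is identified with the mixed graph in which each edge $\{x,y\}$ gives both arcs $(x,y),(y,x)$; thus $G$ is an undirected graph when $\mathcal{A}=\mathcal{A}^{-1}$. The $\eta$-function $\theta:\mathcal{A}^{\pm}\to\mathbb{R}$ of $G$ is defined by $\theta(a)=\eta$ if $a\in\mathcal{A}\setminus\mathcal{A}^{-1}$, $\theta(a)=-\eta$ if $a\in\mathcal{A}^{-1}\setminus\mathcal{A}$, and $\theta(a)=0$ if $a\in\mathcal{A}\cap\mathcal{A}^{-1}$.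 Define $K\in\mathbb{C}^{V\times\mathcal{A}^{\pm}}$ by $K_{x,a}=\frac{1}{\sqrt{\deg_G x}}\delta_{x,t(a)}$, $C=2K^*K-I$, $(S_\theta)_{a,b}=e^{\theta(b)i}\delta_{a,b^{-1}}$ for $a,b\in\mathcal{A}^{\pm}$, and the time evolution matrix $U_\theta=S_\theta C\in\mathbb{C}^{\mathcal{A}^{\pm}\times\mathcal{A}^{\pm}}$. The mixed graph $G$ (equipped with $\theta$) is periodic if there is a positive integer $\tau$ with $U_\theta^{\tau}=I$. *)

(* Defs.v *)
From mathcomp Require Import all_boot all_order all_algebra.
From mathcomp Require Import all_classical all_reals all_analysis.
From mathcomp Require Import complex.

Set Implicit Arguments.
Unset Strict Implicit.
Unset Printing Implicit Defensive.

Import Order.TTheory GRing.Theory Num.Theory.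
Local Open Scope ring_scope.
Local Open Scope complex_scope.

Record mixed_graph (V : finType) := MixedGraph {
  arcs : {set V * V};
  arcs_loopless : forall x : V, (x, x) \notin arcs
}.

Section MixedGraph.
Variables (V : finType) (G : mixed_graph V).

Definition arc_inv (a : V * V) : V * V := (a.2, a.1).

Definition inv_arcs : {set V * V} := [set arc_inv a | a in arcs G].

Definition sym_arcs : {set V * V} := arcs G :|: inv_arcs.

Definition sym_arc : Type := {a : V * V | a \in sym_arcs}.

Definition adj : rel V := fun x y => (x, y) \in sym_arcs.

Definition weakly_connected : Prop := forall x y : V, connect adj x y.

Definition deg (x : V) : nat := #|[set y | adj x y]|.

Definition k_regular (k : nat) : Prop := forall x : V, deg x = k.

Definition undirected : Prop := arcs G = inv_arcs.

Definition num_triangles : nat :=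
  #|[set T : {set V} | (#|T| == 3)%N &&
      [forall x in T, forall y in T, (x != y) ==> adj x y]]|.

End MixedGraph.

Section TimeEvolution.
Variables (R : realType) (V : finType) (G : mixed_graph V).

Definition eta_function (eta : R) (a : sym_arc G) : R :=
  if val a \in arcs G :\: inv_arcs G then eta
  else if val a \in inv_arcs G :\: arcs G then - eta
  else 0.

Definition expi (x : R) : R[i] := cos x +i* sin x.

(* Rows and columns are indexed by V and sym_arc G through enum_val. *)
Definition bdry_mx : 'M[R[i]]_(#|V|, #|{: sym_arc G}|) :=
  \matrix_(x, a)
    (((Num.sqrt (deg G (enum_val x))%:R)^-1 : R)%:C
     * (enum_val x == (val (enum_val a)).2)%:R).

Definition coin_mx : 'M[R[i]]_#|{: sym_arc G}| :=
  2%:R *: ((map_mx Num.conj bdry_mx)^T *m bdry_mx) - 1%:M.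

Definition shift_mx (theta : sym_arc G -> R) : 'M[R[i]]_#|{: sym_arc G}| :=
  \matrix_(a, b)
    (expi (theta (enum_val b))
     * (val (enum_val a) == arc_inv (val (enum_val b)))%:R).

Definition evolution_mx (theta : sym_arc G -> R) : 'M[R[i]]_#|{: sym_arc G}| :=
  shift_mx theta *m coin_mx.

Definition periodic_walk (theta : sym_arc G -> R) : Prop :=
  exists tau : nat, (0 < tau)%N /\ evolution_mx theta ^+ tau = 1%:M.

End TimeEvolution.

(* Main.v *)
Require Import Defs.
From mathcomp Require Import all_boot all_order all_algebra.
From mathcomp Require Import all_classical all_reals all_analysis.
From mathcomp Require Import separable cyclotomic complex ring.

Import Order.TTheory GRing.Theory Num.Theory.
Local Open Scope ring_scope.

(** A periodic walk matrix U has only roots of unity as eigenvalues, so every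
    elementary symmetric function of its eigenvalues is an algebraic integer.
    By Newton's identities the second and third of these are polynomials with
    rational coefficients in tr U, tr U^2, tr U^3
    ([trace_identities_integral]); dividing by 2 and by 6 there, which integral
    power sums alone would not permit, is what yields 2n/k rather than 4n/k and
    16t/k^3 rather than 48t/k^3.

    The traces are computed through the smaller matrix T = K S K^*, indexed by
    vertices.  Since K K^* = 1 and S^2 = 1, cyclicity of the trace turns words in
    S and K^* K into words in T ([mxtrace_walk], [mxtrace_walk2],
    [mxtrace_walk3]).  Now k T is the Hermitian adjacency matrix of G twisted by
    the phases of the arcs ([discriminant_mxE]).  As G has no
    loops and opposite arcs carry inverse phases, tr T = 0 and tr T^2 = n/k;
    when G is undirected the phases are trivial and tr T^3 counts closed walks
    of length 3, which gives 6t/k^3 ([card_ordered_triangles]).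

    With m the number of arcs of the underlying graph and tr S = 0, this makes
    e_2(U) = 2n - 2n/k - m/2, and e_3(U) = 16t/k^3 if G is undirected.  The
    stray m/2 is -e_2(S), and S is an involution, so m/2 is an algebraic integer
    for the same reason.  Both quotients are therefore rational algebraic integers, hence integers
    ([integral_rat_int]). *)

(** * Integrality of symmetric functions of eigenvalues *)

(** Z is integrally closed in Q: if a monic integer polynomial p vanishes at q,
    Gauss's lemma makes X - q proportional to an integer factor of p, whose
    leading coefficient divides 1. *)
Lemma integral_rat_int (F : numFieldType) (q : rat) :
  integralOver (intr : int -> F) (ratr q) -> q \is a Num.int.
Proof.
case=> p mon_p.
have -> : map_poly intr p = map_poly ratr (map_poly intr p) :> {poly F}.
  by rewrite -map_poly_comp; apply: eq_map_poly => b /=; rewrite ratr_int.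
rewrite fmorph_root -dvdp_XsubCl => /dvdpP_rat_int[p1 [a _ Dq] [r Dp]].
have lc1 : lead_coef p1 * lead_coef r = 1.
  by rewrite -lead_coefM -Dp (monicP mon_p).
have /eqP : lead_coef ('X - q%:P) = 1 by rewrite lead_coefXsubC.
rewrite Dq lead_coefZ lead_coef_map_inj //; last exact: intr_inj.
move=> /eqP lca.
(* As lead_coef p1 is a unit of Z with inverse lead_coef r, the scalar a is an
   integer. *)
have aE : a = (lead_coef r)%:~R.
  by rewrite -[LHS]mulr1 -[X in _ * X]/(1%:~R) -lc1 intrM mulrA lca mul1r.
have : ('X - q%:P)`_0 = a * (p1`_0)%:~R by rewrite Dq coefZ coef_map.
rewrite coefB coefX coefC /= sub0r => /(canRL (@opprK _)) ->.
by rewrite aE rpredN rpredM // intr_int.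
Qed.

(** X^tau - 1 is separable and annihilates A, so A is diagonalizable; its
    eigenvalues, with multiplicity, are the entries of d. *)
Lemma trace_mx_torsion (F : numClosedFieldType) (n tau : nat) (A : 'M[F]_n) :
  (0 < tau)%N -> A ^+ tau = 1%:M ->
  exists2 d : 'rV[F]_n, (forall i, d 0 i ^+ tau = 1) &
    forall j, \tr (A ^+ j) = \sum_i d 0 i ^+ j.
Proof.
case: n A => [|n] A tau_gt0 Atau.
  by exists 0 => [[]//|j]; rewrite /mxtrace !big_ord0.
have [rs Drs] := closed_field_poly_normal ('X^tau - 1 : {poly F}).
rewrite (monicP (monicXnsubC 1 tau_gt0)) scale1r in Drs.
have Urs : uniq rs.
  rewrite -separable_prod_XsubC -Drs separable_Xn_sub_1 //.
  by rewrite pnatr_eq0 -lt0n.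
have /diagonalizableP[P Pu /diagonalizable_forPex[d /(simmxRL Pu) Dd]] :
    exists2 rs, uniq rs & mxminpoly A %| \prod_(x <- rs) ('X - x%:P).
  exists rs => //; rewrite -Drs; apply: mxminpoly_min.
  by rewrite rmorphB rmorph1 rmorphXn /= horner_mx_X Atau subrr.
have dX j : diag_mx (map_mx (fun x => x ^+ j) d) = P *m A ^+ j *m invmx P.
  elim: j => [|j IHj].
    rewrite mulmx1 mulmxV //; apply/matrixP=> a b; rewrite !mxE expr0 //.
  rewrite exprS -[A * _]/(A *m _).
  have -> : P *m (A *m A ^+ j) *m invmx P
          = (P *m A *m invmx P) *m (P *m A ^+ j *m invmx P).
    by rewrite !mulmxA mulmxKV.
  rewrite -IHj -Dd mulmx_diag; congr diag_mx; apply/rowP=> i.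
  by rewrite !mxE exprS.
exists d => [i|j].
  have /matrixP/(_ i i) := dX tau; rewrite Atau mulmx1 mulmxV // !mxE eqxx.
  by rewrite !mulr1n.
have -> : \tr (A ^+ j) = \tr (P *m A ^+ j *m invmx P).
  by rewrite mxtrace_mulC mulKmx.
by rewrite -dX mxtrace_diag; apply: eq_bigr => i _; rewrite mxE.
Qed.

(** Here e2 and e3 are the elementary symmetric functions of s, built up one
    root at a time; the equations are Newton's identities cleared of
    denominators. *)
Lemma elementary_symmetric_integral (F : fieldType) (s : seq F) :
  {in s, forall z, integralOver (intr : int -> F) z} ->
  let p j := \sum_(z <- s) z ^+ j in
  exists e2 e3, [/\ integralOver (intr : int -> F) e2,
    integralOver (intr : int -> F) e3,
    p 1%N ^+ 2 - p 2%N = 2%:R * e2 &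
    p 1%N ^+ 3 - 3%:R * p 1%N * p 2%N + 2%:R * p 3%N = 6%:R * e3].
Proof.
elim: s => [|z s IHs] s_int /=.
  exists 0, 0; split; try exact: mxpoly.integral0; rewrite !big_nil; ring.
have [y ys|e2 [e3 [e2_int e3_int E2 E3]]] := IHs.
  by apply: s_int; rewrite inE ys orbT.
have z_int : integralOver (intr : int -> F) z by apply: s_int; rewrite mem_head.
have p1_int : integralOver (intr : int -> F) (\sum_(y <- s) y ^+ 1).
  rewrite big_seq_cond; apply: big_ind => [|x y|y]; first exact: mxpoly.integral0.
    exact: integral_add.
  by rewrite andbT expr1 => ys; apply: s_int; rewrite inE ys orbT.
exists (e2 + z * (\sum_(y <- s) y ^+ 1)), (e3 + z * e2).
split; try by [apply: integral_add => //; apply: integral_mul].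
  rewrite !big_cons.
  move: E2; set p1 := \sum_(y <- s) y ^+ 1; set p2 := \sum_(y <- s) y ^+ 2.
  move=> E2; rewrite mulrDr -E2; ring.
rewrite !big_cons; move: E2 E3.
set p1 := \sum_(y <- s) y ^+ 1; set p2 := \sum_(y <- s) y ^+ 2.
set p3 := \sum_(y <- s) y ^+ 3; move=> E2 E3.
have -> : 6%:R * (e3 + z * e2) = 6%:R * e3 + 3%:R * z * (2%:R * e2) by ring.
rewrite -E2 -E3; ring.
Qed.

Lemma trace_identities_integral (F : numClosedFieldType) (n tau : nat)
    (A : 'M[F]_n) :
  (0 < tau)%N -> A ^+ tau = 1%:M ->
  exists e2 e3, [/\ integralOver (intr : int -> F) e2,
    integralOver (intr : int -> F) e3,
    \tr A ^+ 2 - \tr (A ^+ 2) = 2%:R * e2 &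
    \tr A ^+ 3 - 3%:R * \tr A * \tr (A ^+ 2) + 2%:R * \tr (A ^+ 3) = 6%:R * e3].
Proof.
move=> tau_gt0 /(trace_mx_torsion _ _ _ _ tau_gt0)[d d_tau trE].
have [|e2 [e3]] := elementary_symmetric_integral F [seq d 0 i | i <- enum 'I_n].
  move=> _ /mapP[i _ ->].
  exists ('X^tau - 1); first exact: monicXnsubC.
  by rewrite rmorphB rmorph1 /= map_polyXn rootE !hornerE d_tau subrr.
rewrite /= !big_map -!trE expr1 => E; by exists e2, e3.
Qed.

(** * Traces of powers of a walk matrix *)
Section WalkTraces.
Context {F : comNzRingType} {n m : nat}.
Variables (K : 'M[F]_(n, m)) (L : 'M[F]_(m, n)) (S : 'M[F]_m).
(* L plays the role of the adjoint K^*. *)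
Hypotheses (KL : K *m L = 1%:M) (SS : S *m S = 1%:M).
Let U := S *m (2%:R *: (L *m K) - 1%:M).
Let T := K *m S *m L.
Let X := S *m (L *m K).

Let UE : U = 2%:R *: X - S.
Proof. by rewrite /U mulmxBr mulmx1 -scalemxAr. Qed.

Let trX : \tr X = \tr T.
Proof. by rewrite /X mulmxA mxtrace_mulC mulmxA. Qed.

Let XX : X *m X = S *m L *m T *m K.
Proof. by rewrite /X /T !mulmxA. Qed.

Let trXX : \tr (X *m X) = \tr (T ^+ 2).
Proof. by rewrite XX mxtrace_mulC -[T ^+ 2]/(T *m T) /T !mulmxA. Qed.

Let trXS : \tr (X *m S) = n%:R.
Proof. by rewrite mxtrace_mulC mulmxA SS mul1mx mxtrace_mulC KL mxtrace1. Qed.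

Let trXXX : \tr (X *m X *m X) = \tr (T ^+ 3).
Proof.
rewrite XX /X (mulmxA S L K) (mulmxA _ (S *m L) K) mxtrace_mulC.
by rewrite -[T ^+ 3]/(T *m (T *m T)) /T !mulmxA.
Qed.

Let trXXS : \tr (X *m X *m S) = \tr T.
Proof.
rewrite XX mxtrace_mulC -!(mulmxA S) (mulmxA S S) SS mul1mx.
by rewrite -mulmxA mxtrace_mulC -(mulmxA T) KL mulmx1.
Qed.

Let trXSS : \tr (X *m S *m S) = \tr T.
Proof. by rewrite -mulmxA SS mulmx1. Qed.

Lemma mxtrace_walk : \tr U = 2%:R * \tr T - \tr S.
Proof. by rewrite UE raddfB /= mxtraceZ trX. Qed.

Lemma mxtrace_walk2 : \tr (U ^+ 2) = 4%:R * \tr (T ^+ 2) - 4%:R * n%:R + m%:R.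
Proof.
rewrite -[U ^+ 2]/(U *m U) UE mulmxBl !mulmxBr.
rewrite -!(scalemxAl, scalemxAr) SS !raddfB /= !mxtraceZ.
rewrite (mxtrace_mulC S X) trXX trXS mxtrace1; ring.
Qed.

Lemma mxtrace_walk3 : \tr (U ^+ 3) = 8%:R * \tr (T ^+ 3) - 6%:R * \tr T - \tr S.
Proof.
rewrite -[U ^+ 3]/(U *m (U *m U)) UE !(mulmxBl, mulmxBr).
rewrite -!(scalemxAl, scalemxAr) SS !raddfB /= !mxtraceZ !mulmx1.
have -> : \tr (X *m (X *m X)) = \tr (T ^+ 3) by rewrite mulmxA.
have -> : \tr (X *m (X *m S)) = \tr T by rewrite mulmxA.
have -> : \tr (X *m (S *m X)) = \tr T by rewrite mxtrace_mulC -mulmxA mxtrace_mulC.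
have -> : \tr (S *m (X *m X)) = \tr T by rewrite mxtrace_mulC.
have -> : \tr (S *m (X *m S)) = \tr T by rewrite mxtrace_mulC.
have -> : \tr (S *m (S *m X)) = \tr T by rewrite mulmxA SS mul1mx.
rewrite trX; ring.
Qed.

End WalkTraces.

(** * Arcs and triangles of a mixed graph *)
Section MixedGraphs.
Context {V : finType} (G : mixed_graph V).

Lemma arc_invK : involutive (@arc_inv V).
Proof. by case. Qed.

Lemma mem_inv_arcs p : (p \in inv_arcs G) = (arc_inv p \in arcs G).
Proof.
apply/imsetP/idP => [[q qG ->]|pG]; first by rewrite arc_invK.
by exists (arc_inv p); rewrite ?arc_invK.
Qed.

Lemma mem_sym_arcs_inv p : (arc_inv p \in sym_arcs G) = (p \in sym_arcs G).
Proof. by rewrite !inE !mem_inv_arcs arc_invK orbC. Qed.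

Lemma adjC x y : adj G x y = adj G y x.
Proof. by rewrite /adj -mem_sym_arcs_inv. Qed.

Lemma adjxx x : adj G x x = false.
Proof. by rewrite /adj !inE mem_inv_arcs orbb (negPf (arcs_loopless _ _)). Qed.

Lemma sum_sym_arc (M : nmodType) (f : V * V -> M) :
  \sum_(a < #|{: sym_arc G}|) f (val (enum_val a)) = \sum_(p in sym_arcs G) f p.
Proof.
rewrite [RHS]big_sub; transitivity (\sum_(a in {: sym_arc G}) f (val a)).
  by rewrite [RHS]big_enum_val.
exact: eq_bigl.
Qed.

Lemma sum_adj x : (\sum_y adj G x y = deg G x)%N.
Proof.
rewrite /deg -sum1dep_card [RHS]big_mkcond /=.
by apply: eq_bigr => y _; case: adj.
Qed.

(** The degree counts neighbours through arcs leaving y; arc reversal moves the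
    count to arcs entering y, which is how K sees them. *)
Lemma sum_in_arcs (A : pzSemiRingType) y :
  \sum_(p in sym_arcs G) (y == p.2)%:R = (deg G y)%:R :> A.
Proof.
rewrite (reindex_inj (inv_inj arc_invK)) /=.
under eq_bigl do rewrite mem_sym_arcs_inv.
rewrite big_mkcond /=.
transitivity (\sum_u \sum_v (if adj G u v then (y == u)%:R else 0 : A)).
  by rewrite pair_bigA; apply: eq_bigr => -[u v].
rewrite (bigD1 y) //= [X in _ + X]big1 ?addr0 => [|u /negPf uy].
  by rewrite eqxx -big_mkcond sumr_const /deg cardsE.
by rewrite big1 // => v _; rewrite eq_sym uy if_same.
Qed.

Definition triangles : {set {set V}} :=
  [set T : {set V} | (#|T| == 3)%N &&
      [forall x in T, forall y in T, (x != y) ==> adj G x y]].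

Definition ordered_triangle x y z := adj G x y && adj G y z && adj G z x.

Lemma ordered_triangle_vertices x y z : ordered_triangle x y z ->
  [set x; y; z]%SET \in triangles.
Proof.
move=> /andP[/andP[xy yz] zx].
have [nxy nyz nzx] : [/\ x != y, y != z & z != x].
  by split; apply/eqP=> e; move: xy yz zx; rewrite e ?adjxx.
rewrite inE; apply/andP; split.
  by rewrite finset.setUC cardsU1 cards2 !inE nxy (negPf nzx) (eq_sym z) (negPf nyz).
apply/forall_inP => u; rewrite !inE => uT; apply/forall_inP => v; rewrite !inE => vT.
apply/implyP; move: uT vT.
by move=> /orP[/orP[]|] /eqP-> /orP[/orP[]|] /eqP->; rewrite ?eqxx // adjC.
Qed.

(** Right-hand side: the successive choices of three distinct vertices of T, a
    form in which they can be counted directly. *)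
Lemma ordered_triangle_spanning (T : {set V}) x y z : T \in triangles ->
  ordered_triangle x y z && ([set x; y; z]%SET == T)
  = [&& x \in T, y \in (T :\ x)%SET & z \in (T :\ x :\ y)%SET].
Proof.
rewrite inE => /andP[/eqP T3 /forall_inP adjT].
apply/andP/and3P => [[/andP[/andP[xy yz] zx] /eqP <-]|].
  have [nxy nyz nzx] : [/\ x != y, y != z & z != x].
    by split; apply/eqP=> e; move: xy yz zx; rewrite e ?adjxx.
  by rewrite !inE !eqxx ?orbT (eq_sym y x) nxy (eq_sym z y) nyz nzx.
rewrite !inE => -[xT /andP[yx yT] /and3P[zy zx zT]].
have adjT' u v : u \in T -> v \in T -> u != v -> adj G u v.
  by move=> uT vT; exact: implyP (forall_inP (adjT u uT) v vT).
split; first by rewrite /ordered_triangle !adjT' // eq_sym.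
rewrite eqEcard T3; apply/andP; split.
  by apply/fintype.subsetP=> u; rewrite !inE => /orP[/orP[]|] /eqP->.
by rewrite finset.setUC cardsU1 cards2 !inE (negPf zx) (negPf zy) eq_sym yx.
Qed.

(** Each triangle has 3 * 2 * 1 orderings of its vertices. *)
Lemma card_ordered_triangles :
  (\sum_x \sum_y \sum_z (adj G x y && adj G y z && adj G z x) =
   6 * num_triangles G)%N.
Proof.
transitivity (\sum_x \sum_y \sum_z \sum_(T in triangles)
    (ordered_triangle x y z && ([set x; y; z]%SET == T)))%N.
  apply: eq_bigr => x _; apply: eq_bigr => y _; apply: eq_bigr => z _.
  rewrite -/(ordered_triangle x y z).
  have [xyz|_] := boolP (ordered_triangle x y z); last by rewrite big1.
  rewrite (bigD1 [set x; y; z]%SET) ?ordered_triangle_vertices //= eqxx.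
  by rewrite big1 // => T /andP[_ /negPf]; rewrite eq_sym => ->.
under eq_bigr => x _ do under eq_bigr => y _ do rewrite exchange_big.
under eq_bigr => x _ do rewrite exchange_big.
rewrite exchange_big /= mulnC -[num_triangles G]/#|triangles| -sum_nat_const.
apply: eq_bigr => T Ttri.
have /andP[/eqP T3 _] : (#|T| == 3)%N &&
    [forall x in T, forall y in T, (x != y) ==> adj G x y] by rewrite inE in Ttri.
transitivity (\sum_(x in T) \sum_(y in (T :\ x)%SET)
    \sum_(z in (T :\ x :\ y)%SET) 1)%N.
  rewrite [RHS]big_mkcond; apply: eq_bigr => x _.
  under eq_bigr do under eq_bigr do rewrite ordered_triangle_spanning //.
  case: ifP => xT /=; last by rewrite big1 // => y _; rewrite big1.
  rewrite [RHS]big_mkcond; apply: eq_bigr => y _.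
  case: ifP => yT /=; last by rewrite big1.
  by rewrite [RHS]big_mkcond; apply: eq_bigr => z _; case: ifP.
have cardD (A : {set V}) u : u \in A -> #|(A :\ u)%SET| = #|A|.-1.
  by move=> uA; rewrite (cardsD1 u A) uA.
transitivity (\sum_(x in T) \sum_(y in (T :\ x)%SET) 1)%N.
  apply: eq_bigr => x xT; apply: eq_bigr => y yT.
  by rewrite sum1_card !cardD // T3.
transitivity (\sum_(x in T) 2)%N.
  by apply: eq_bigr => x xT; rewrite sum1_card cardD // T3.
by rewrite sum_nat_const T3.
Qed.
End MixedGraphs.

(** * The matrices of the walk *)
Section WalkMatrices.
Local Open Scope complex_scope.
Context {R : realType} {V : finType} (G : mixed_graph V) (eta : R).

(** The phase is defined on all pairs of vertices, so that sums over the
    subtype of arcs can be rewritten as sums over pairs ([sum_sym_arc]). *)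
Definition phase (p : V * V) : R[i] :=
  expi (if p \in arcs G :\: inv_arcs G then eta
        else if p \in inv_arcs G :\: arcs G then - eta else 0).

(** The eta-function is odd under arc reversal. *)
Lemma phase_inv p : phase (arc_inv p) * phase p = 1.
Proof.
have expiN x : expi (- x) * expi x = 1 :> R[i].
  by rewrite /expi cosN sinN; apply/eqP; rewrite eq_complex /=; apply/andP; split;
  apply/eqP; [rewrite -[RHS](cos2Dsin2 x)|]; ring.
rewrite /phase !inE !mem_inv_arcs arc_invK.
have ee : expi eta * expi (- eta) = 1 by rewrite mulrC expiN.
have e0 : expi 0 * expi 0 = 1 :> R[i] by rewrite -[X in expi X * _]oppr0 expiN.
by case: (p \in _); case: (arc_inv p \in _) => /=.
Qed.

Lemma phase_undirected p : undirected G -> phase p = 1.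
Proof.
rewrite /phase => <-; by rewrite finset.setDv inE /expi cos0 sin0.
Qed.

Let S := shift_mx (@eta_function R V G eta).
Let K := bdry_mx R G.

Lemma shift_mxE a b :
  S a b = phase (val (enum_val b))
    * (val (enum_val a) == arc_inv (val (enum_val b)))%:R.
Proof. by rewrite mxE. Qed.

(** A diagonal entry of S would need an arc equal to its own reversal, that is,
    a loop. *)
Lemma shift_mx_tr0 : \tr S = 0.
Proof.
rewrite /mxtrace big1 // => a _; rewrite shift_mxE.
case: (enum_val a) => -[x y] /= xy.
case: eqP => [[xE _]|]; last by rewrite mulr0.
by have := adjxx G x; rewrite /adj {2}xE xy.
Qed.

(** S reverses arcs, and the phases picked up going back and forth cancel. *)
Lemma shift_mx_involutive : S *m S = 1%:M.
Proof.
apply/matrixP=> a c; rewrite !mxE.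
under eq_bigr do rewrite !shift_mxE.
set pa := val (enum_val a); set pc := val (enum_val c).
rewrite (sum_sym_arc _ _ (fun p => phase p * (pa == arc_inv p)%:R *
  (phase pc * (p == arc_inv pc)%:R))).
rewrite (bigD1 (arc_inv pc)) /=; last by rewrite mem_sym_arcs_inv; exact: valP.
rewrite big1 ?addr0 => [|p /andP[_ /negPf->]]; last by rewrite !mulr0.
rewrite eqxx arc_invK mulr1 mulrAC phase_inv mul1r.
by rewrite /pa /pc (inj_eq val_inj) (inj_eq enum_val_inj).
Qed.

Context (k : nat) (k_gt0 : (0 < k)%N) (regG : k_regular G k).

Let wt : R[i] := ((Num.sqrt k%:R)^-1 : R)%:C.

Lemma bdry_mxE x a : K x a = wt * (enum_val x == (val (enum_val a)).2)%:R.
Proof. by rewrite mxE regG. Qed.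

Lemma bdry_mx_real : map_mx Num.conj K = K.
Proof.
apply/matrixP=> x a; rewrite !mxE rmorphM rmorph_nat; congr (_ * _).
by apply/eqP; rewrite eq_complex /= oppr0 !eqxx.
Qed.

Lemma sqr_bdry_weight : wt * wt = k%:R^-1.
Proof.
rewrite /wt -rmorphM /= -invfM -expr2 sqr_sqrtr ?ler0n //.
by rewrite fmorphV rmorph_nat.
Qed.

(** Each row of K has k nonzero entries, all equal to k^(-1/2), and an arc has
    only one terminus, so distinct rows have disjoint supports. *)
Lemma bdry_mx_coisometry : K *m (map_mx Num.conj K)^T = 1%:M.
Proof.
rewrite bdry_mx_real; apply/matrixP=> x y; rewrite mxE [RHS]mxE.
under eq_bigr do rewrite [K^T _ _]mxE !bdry_mxE mulrACA sqr_bdry_weight.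
rewrite -mulr_sumr (sum_sym_arc _ _ (fun p =>
  (enum_val x == p.2)%:R * (enum_val y == p.2)%:R)).
have [->|xy] := eqVneq x y; last first.
  rewrite big1 ?mulr0 // => p _; case: eqP => [xE|_]; last by rewrite mul0r.
  by rewrite -xE mul1r (inj_eq enum_val_inj) eq_sym (negPf xy).
have -> : \sum_(p in sym_arcs G) ((enum_val y == p.2)%:R * (enum_val y == p.2)%:R)
    = \sum_(p in sym_arcs G) (enum_val y == p.2)%:R :> R[i].
  by apply: eq_bigr => p _; case: eqP => _; rewrite (mulr0, mulr1).
by rewrite sum_in_arcs regG mulVf // pnatr_eq0 -lt0n.
Qed.

(** The matrix T = K S K^* through which the spectrum of the walk is read off
    the graph. *)
Definition discriminant_mx := K *m S *m (map_mx Num.conj K)^T.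
Let T := discriminant_mx.

(** The only arc that contributes to the entry (x, y) is (x, y) itself: K^*
    forces it to end at y, and S sends it to an arc that K forces to end
    at x. *)
Lemma discriminant_mxE x y :
  T x y = k%:R^-1 * (phase (enum_val x, enum_val y)
    * (adj G (enum_val x) (enum_val y))%:R).
Proof.
rewrite /T /discriminant_mx bdry_mx_real mxE.
transitivity (\sum_(b < #|{: sym_arc G}|) k%:R^-1 * (phase (val (enum_val b)) *
   (val (enum_val b) == (enum_val x, enum_val y) :> V * V)%:R)).
  apply: eq_bigr => b _; rewrite [(K *m S) _ _]mxE [K^T _ _]mxE.
  under eq_bigr do rewrite bdry_mxE shift_mxE.
  set p := val (enum_val b).
  rewrite (sum_sym_arc _ _ (fun q =>
    wt * (enum_val x == q.2)%:R * (phase p * (q == arc_inv p)%:R))).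
  rewrite (bigD1 (arc_inv p)) /=; last by rewrite mem_sym_arcs_inv; exact: valP.
  rewrite big1 ?addr0 => [|q /andP[_ /negPf->]]; last by rewrite !mulr0.
  rewrite bdry_mxE -/p eqxx mulr1 -sqr_bdry_weight [RHS]mulrA.
  rewrite [p]surjective_pairing xpair_eqE /= -mulnb natrM (eq_sym p.1) (eq_sym p.2).
  by ring.
rewrite (sum_sym_arc _ _ (fun p =>
  k%:R^-1 * (phase p * (p == (enum_val x, enum_val y))%:R))).
rewrite -mulr_sumr; congr (_ * _); rewrite /adj big_mkcond /=.
rewrite (bigD1 (enum_val x, enum_val y)) //= eqxx big1 ?addr0 => [|p /negPf->].
  by case: ifP => _; rewrite (mulr0, mulr1).
by rewrite mulr0 if_same.
Qed.

Lemma sum_enum_val (f : V -> R[i]) : \sum_(i < #|V|) f (enum_val i) = \sum_x f x.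
Proof. by rewrite [RHS]big_enum_val. Qed.

Lemma mxtrace_discriminant : \tr T = 0.
Proof.
by rewrite /mxtrace big1 // => x _; rewrite discriminant_mxE adjxx !mulr0.
Qed.

(** Opposite entries of T have inverse phases, so each of the nk ordered pairs of
    adjacent vertices contributes k^(-2). *)
Lemma mxtrace_discriminant2 : \tr (T ^+ 2) = #|V|%:R / k%:R.
Proof.
have k_neq0 : k%:R != 0 :> R[i] by rewrite pnatr_eq0 -lt0n.
transitivity (\sum_(x : V) k%:R^-1 : R[i]); last first.
  by rewrite sumr_const mulr_natl.
rewrite -sum_enum_val; apply: eq_bigr => x _.
rewrite -[T ^+ 2]/(T *m T) mxE.
transitivity (\sum_(y : V) (k%:R ^- 2 * (adj G (enum_val x) y)%:R : R[i])).
  rewrite -sum_enum_val; apply: eq_bigr => y _; rewrite !discriminant_mxE.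
  rewrite (adjC _ (enum_val y)).
  have := phase_inv (enum_val x, enum_val y); rewrite /arc_inv /= => ph.
  case: (adj _ _ _); rewrite ?mulr0 // !mulr1 mulrACA [X in _ * X]mulrC ph mulr1.
  by rewrite expr2 invfM.
by rewrite -mulr_sumr -natr_sum sum_adj regG; field.
Qed.

Lemma mxtrace_discriminant3 : undirected G ->
  \tr (T ^+ 3) = (6 * num_triangles G)%:R / k%:R ^+ 3.
Proof.
move=> undG.
have TE x y : T x y = k%:R^-1 * (adj G (enum_val x) (enum_val y))%:R.
  by rewrite discriminant_mxE phase_undirected // mul1r.
rewrite -card_ordered_triangles natr_sum mulr_suml -sum_enum_val.
apply: eq_bigr => x _; rewrite -[T ^+ 3]/(T *m (T *m T)) mxE.
rewrite natr_sum mulr_suml -sum_enum_val; apply: eq_bigr => y _.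
rewrite [(T *m T) _ _]mxE natr_sum mulr_suml mulr_sumr -sum_enum_val.
apply: eq_bigr => z _.
rewrite !TE -!mulnb !natrM -exprVn; ring.
Qed.

End WalkMatrices.

(** * Divisibility conditions for periodicity *)

Theorem theorem1p2 (R : realType) (eta : R) (V : finType) (G : mixed_graph V)
    (k : nat)
    (eta_ge0 : 0 <= eta) (eta_lt2pi : eta < 2 * pi)
    (connG : weakly_connected G)
    (k_ge1 : (1 <= k)%N) (regG : k_regular G k)
    (perG : periodic_walk (@eta_function R V G eta)) :
  ((2 * #|V|)%:R / k%:R : rat) \is a Num.int
  /\
  (forall t : nat, undirected G -> num_triangles G = t ->
     ((16 * t)%:R / (k%:R ^+ 3) : rat) \is a Num.int).
Proof.
have [tau [tau_gt0 Utau]] := perG.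
pose S := shift_mx (@eta_function R V G eta).
have KK := bdry_mx_coisometry (R := R) G k k_ge1 regG.
have SS := shift_mx_involutive G eta.
have trS := shift_mx_tr0 G eta.
have trT := mxtrace_discriminant G eta k regG.
have trT2 := mxtrace_discriminant2 G eta k k_ge1 regG.
have trT3 := mxtrace_discriminant3 G eta k regG.
have trU := mxtrace_walk (bdry_mx R G) (map_mx Num.conj (bdry_mx R G))^T S.
have trU2 := mxtrace_walk2 _ _ _ KK SS.
have trU3 := mxtrace_walk3 _ _ _ KK SS.
rewrite -/(discriminant_mx G eta) trT trS in trU trU2 trU3.
have k_neq0 : k%:R != 0 :> complex R by rewrite pnatr_eq0 -lt0n.
have nat_neq0 j : j.+1%:R != 0 :> complex R by rewrite pnatr_eq0.
have [e2 [e3 [e2_int e3_int E2 E3]]] :=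
  trace_identities_integral _ _ _ _ tau_gt0 Utau.
have [f2 [_ [f2_int _ F2 _]]] := trace_identities_integral _ _ 2 S isT SS.
have SS2 : S ^+ 2 = 1%:M by [].
rewrite trS SS2 mxtrace1 expr0n sub0r in F2.
rewrite /evolution_mx /coin_mx trU trU2 in E2 E3.
rewrite trU3 in E3.
split.
  apply: (integral_rat_int (complex R)).
  (* e2 = 2n - 2n/k - m/2 and f2 = - m/2, with m the number of arcs. *)
  suff -> : ratr ((2 * #|V|)%:R / k%:R) = (2 * #|V|)%:R - e2 + f2 :> complex R.
    by apply: integral_add => //; apply: integral_sub => //; exact: integral_nat.
  apply: (mulfI (nat_neq0 1)); rewrite mulrDr -F2 mulrBr -E2 trT2.
  rewrite fmorph_div !rmorph_nat natrM; field.
  exact: k_neq0.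
move=> t undG tE; apply: (integral_rat_int (complex R)).
suff -> : ratr ((16 * t)%:R / k%:R ^+ 3) = e3 by [].
apply: (mulfI (nat_neq0 5)); rewrite -E3 trT3 // tE.
rewrite fmorph_div rmorphXn !rmorph_nat !natrM; field.
exact: k_neq0.
Qed.
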